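(* Every finite simple graph $G$ satisfies $\pi^{c}(G)\le \gamma_R(G)$.
   Context: A roman dominating function of $G$ is a labeling $f:V(G)\to\{0,1,2\}$ such that every vertex labeled $0$ is adjacent to some vertex labeled $2$; the roman domination number $\gamma_R(G)$ is the minimum of $\sum_v f(v)$ over roman dominating functions. A configuration of cops on $G$ is a function $C:V(G)\to\mathbb{Z}_{\ge 0}$ of size $\sum_v C(v)$. A pebbling step from a vertex $u$ with at least two cops to an adjacent vertex $v$ removes two cops from $u$ and adds one cop to $v$. In the cops and robbers pebbling game, cops are placed according to $C$, then a robber chooses a starting vertex; thereafter, in each turn the cops make pebbling steps, after which the robber either moves to an adjacent vertex or stays put. The robber is captured when he occupies a vertex holding at least one cop. The cop pebbling number $\pi^{c}(G)$ is the minimum $m$ such that some configuration of size $m$ allows the cops to capture the robber regardless of how he starts and moves. *)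

(* Defs.v *)
From mathcomp Require Import all_boot.
From mathcomp Require Import boolp.

Set Implicit Arguments.
Unset Strict Implicit.
Unset Printing Implicit Defensive.

(* A finite simple graph is given by its adjacency relation e : rel V on a    *)
(* finType V, with hypotheses symmetric e and irreflexive e.                  *)

Section RomanDomination.

Variables (V : finType) (e : rel V).

Definition roman_dominating (f : {ffun V -> 'I_3}) : bool :=
  [forall v, (f v == 0 :> nat) ==> [exists u, e v u && (f u == 2 :> nat)]].

Definition roman_weight (f : {ffun V -> 'I_3}) : nat := \sum_v f v.

Definition roman_dominated_by (m : nat) : bool :=
  [exists f, roman_dominating f && (roman_weight f == m)].

Lemma roman_dominated_by_ex : exists m, roman_dominated_by m.
Proof.
exists (roman_weight [ffun=> inord 1]); apply/existsP.
exists [ffun=> inord 1]; rewrite eqxx andbT.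
by apply/forallP => v; rewrite ffunE inordK.
Qed.

Definition roman_domination_number : nat := ex_minn roman_dominated_by_ex.

End RomanDomination.

Section CopPebbling.

Variables (V : finType) (e : rel V).

Definition config := {ffun V -> nat}.

Definition config_size (C : config) : nat := \sum_v C v.

Definition pebbling_move (C : config) (u v : V) : config :=
  [ffun w => C w - (if w == u then 2 else 0) + (if w == v then 1 else 0)].

Definition pebbling_step : rel config := fun C C' =>
  [exists u, exists v, [&& e u v, 2 <= C u & C' == pebbling_move C u v]].

(* A turn of the cops is a finite, possibly empty, sequence of pebbling steps *)
(* performed one after the other.                                             *)
Definition cops_turn (C C' : config) : Prop :=
  exists2 s : seq config, path pebbling_step C s & last C s = C'.

(* cops_win C r: with the cops at C, the robber at r and the cops to play,    *)
(* the cops can force a capture in finitely many turns. The robber replies to *)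
(* a turn of the cops only if that turn has not captured him, hence the       *)
(* second constructor; a robber moving onto a cop is captured by the first.   *)
Inductive cops_win : config -> V -> Prop :=
| CopsWinCaptured (C : config) r : 0 < C r -> cops_win C r
| CopsWinCapture (C C' : config) r : cops_turn C C' -> 0 < C' r -> cops_win C r
| CopsWinTurn (C C' : config) r : cops_turn C C' ->
    (forall r', (r' == r) || e r r' -> cops_win C' r') -> cops_win C r.

(* The robber chooses his starting vertex knowing C.                          *)
Definition winning_config (C : config) : Prop := forall r, cops_win C r.

Definition cops_suffice (m : nat) : Prop :=
  exists2 C : config, config_size C = m & winning_config C.

Lemma cops_suffice_ex : exists m, `[< cops_suffice m >].
Proof.
exists (config_size [ffun=> 1]); apply/asboolP; exists [ffun=> 1] => // r.
by apply: CopsWinCaptured; rewrite ffunE.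
Qed.

Definition cop_pebbling_number : nat := ex_minn cops_suffice_ex.

End CopPebbling.

(* Main.v *)
(* The labels of a Roman dominating function, read as numbers of cops, form a
   winning configuration: a robber on a vertex without cops has a neighbor
   holding two of them, and one pebbling step from there captures him. *)

Require Import Defs.
From mathcomp Require Import all_boot.
From mathcomp Require Import boolp.

Lemma roman_dominating_winning (V : finType) (e : rel V) (f : {ffun V -> 'I_3}) :
  symmetric e -> roman_dominating e f ->
  winning_config e [ffun v => nat_of_ord (f v)].
Proof.
move=> e_sym /forallP f_dom r.
have [fr0|fr_gt0] := posnP (f r); last by apply: CopsWinCaptured; rewrite ffunE.
have /existsP[u /andP[e_ru /eqP fu2]] := implyP (f_dom r) (introT eqP fr0).
set C : config V := finfun _.
apply: (@CopsWinCapture _ _ _ (pebbling_move C u r)); last first.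
  (* The cop that arrives makes the count at [r] a successor, whatever the truncated subtraction
     leaves there. *)
  by rewrite ffunE eqxx addn1.
exists [:: pebbling_move C u r] => //=; rewrite andbT.
(* Domination gives the edge from [r] to [u]; the cops cross it in the opposite direction. *)
by apply/existsP; exists u; apply/existsP; exists r; rewrite e_sym e_ru ffunE fu2 /=.
Qed.

Theorem theorem5 (V : finType) (e : rel V)
    (e_sym : symmetric e) (e_irr : irreflexive e) :
  cop_pebbling_number e <= roman_domination_number e.
Proof.
rewrite /roman_domination_number; case: ex_minnP => m.
case/existsP=> f /andP[f_dom /eqP <-] _.
(* By minimality of [n], it is enough that some winning configuration has the weight of [f] as its
   size. *)
rewrite /cop_pebbling_number; case: ex_minnP => n _; apply; apply/asboolP.
exists [ffun v => nat_of_ord (f v)]; last exact: roman_dominating_winning.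
by apply: eq_bigr => v _; rewrite ffunE.
Qed.
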